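(* Let $G$ be a cubic graph with a Hist $T$, and let $H = \langle E(G) - E(T)\rangle$. Then $H$ is a non-separating $2$-regular subgraph of $G$ satisfying $|V(H)| = |V(G)|/2 + 1$.
   Context: All graphs are finite and simple. A cubic graph is a $3$-regular graph. A Hist (homeomorphically irreducible spanning tree) of a connected graph $G$ is a spanning tree of $G$ which has no vertex of degree two (degree taken in the tree). For a set $S$ of edges of $G$, $\langle S\rangle$ denotes the subgraph of $G$ induced by the edges in $S$: its edge set is $S$ and its vertex set is the set of end vertices of edges in $S$. A $2$-regular subgraph $H$ of a connected graph $G$ is called non-separating if $G - E(H)$ (the graph obtained by deleting the edges of $H$ and keeping all vertices) is connected. *)

(* Defs.v *)
From mathcomp Require Import all_boot all_order all_algebra.
Set Implicit Arguments. Unset Strict Implicit. Unset Printing Implicit Defensive.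

(* Finite simple graphs whose vertices are drawn from an ambient finite type
   U.  The vertex set need not be all of U, so that a graph and its subgraphs
   live in the same type; edges are 2-element sets of vertices. *)
Record graph (U : finType) := Graph {
  vset : {set U};
  eset : {set {set U}};
  esetP : [forall e in eset, (e \subset vset) && (#|e| == 2)]
}.

Section Graphs.
Variable U : finType.
Implicit Types (G H T : graph U) (S : {set {set U}}) (x y : U).

Definition adj G : rel U := [rel x y | [set x; y] \in eset G].

Definition degree G x : nat := #|[set e in eset G | x \in e]|.

Definition regular (k : nat) G : Prop := {in vset G, forall x, degree G x = k}.

Definition cubic G : Prop := regular 3 G.

Definition subgraph H G : Prop := vset H \subset vset G /\ eset H \subset eset G.

(* The graph without vertices is not connected. *)
Definition connected G : Prop :=
  vset G != set0 /\ {in vset G &, forall x y, connect (adj G) x y}.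

Definition acyclic G : Prop :=
  forall c : seq U, 3 <= size c -> ~ ucycle (adj G) c.

Definition tree G : Prop := connected G /\ acyclic G.

Definition spanning_tree G T : Prop :=
  [/\ subgraph T G, vset T = vset G & tree T].

(* Connectedness of G is not required separately: it follows from the existence
   of a spanning tree. *)
Definition hist G T : Prop :=
  spanning_tree G T /\ {in vset T, forall x, degree T x <> 2}.

Lemma edge_induced_subproof G S :
  [forall e in eset G :&: S, (e \subset cover (eset G :&: S)) && (#|e| == 2)].
Proof.
apply/forall_inP => e eS; rewrite bigcup_sup //=.
by case/setIP: eS => /(forall_inP (esetP G))/andP[].
Qed.

(* The subgraph of G induced by a set S of edges of G.  Elements of S that are
   not edges of G are ignored, which makes the operation total. *)
Definition edge_induced G S : graph U := Graph (edge_induced_subproof G S).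

Lemma del_edges_subproof G S :
  [forall e in eset G :\: S, (e \subset vset G) && (#|e| == 2)].
Proof.
by apply/forall_inP => e /setDP[eG _]; exact: (forall_inP (esetP G)).
Qed.

Definition del_edges G S : graph U := Graph (del_edges_subproof G S).

Definition non_separating G H : Prop :=
  [/\ connected G, subgraph H G, regular 2 H & connected (del_edges G (eset H))].

End Graphs.

(* Main.v *)
Require Import Defs.
From mathcomp Require Import all_boot all_order all_algebra.
From mathcomp Require Import zify lra.
Set Implicit Arguments. Unset Strict Implicit. Unset Printing Implicit Defensive.

(** In the cubic graph a vertex has degree 1 or 3 in the Hist T, hence degree 2
    or 0 in the complement H of T, so the vertices of H are the leaves of T and
    H is 2-regular.  Summing degrees over all vertices, T contributes
    2(|V(G)| - 1) and H contributes 2|V(H)|, for a total of 3|V(G)|. *)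

Section TreeEdges.
Variables (U : finType) (G : graph U).
Implicit Types (S : {set U}) (x y : U).

Lemma edge_sub e : e \in eset G -> e \subset vset G.
Proof. by move=> /(forall_inP (esetP G))/andP[]. Qed.

Lemma card_edge e : e \in eset G -> #|e| = 2.
Proof. by move=> /(forall_inP (esetP G))/andP[_ /eqP]. Qed.

Lemma adj_sym : symmetric (adj G).
Proof. by move=> x y; rewrite /adj /= setUC. Qed.

Lemma adj_vset x y : adj G x y -> (x \in vset G) * (y \in vset G).
Proof. by move=> /edge_sub/subsetP exy; split; apply: exy; rewrite !inE eqxx ?orbT. Qed.

Lemma adj_neq x y : adj G x y -> x != y.
Proof. by move=> /card_edge; rewrite cards2; case: (x != y). Qed.

Lemma edge_adj e x : e \in eset G -> x \in e -> exists2 y, adj G x y & e = [set x; y].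
Proof.
move=> eG xe; have /eqP/cards2P[a [b [_ eab]]] := card_edge eG.
move: xe; rewrite eab !inE => /orP[] /eqP->.
  by exists b; rewrite // /adj /= -eab.
by exists a; rewrite /adj /= setUC // -eab.
Qed.

Lemma handshake : \sum_(x in vset G) degree G x = 2 * #|eset G|.
Proof.
transitivity (\sum_(x in vset G) \sum_(e in eset G) (x \in e : nat)).
  apply: eq_bigr => x _; rewrite /degree cardsE -sum1_card big_mkcondr /=.
  by apply: eq_bigr => e _; case: ifP.
rewrite exchange_big /= -[#|_|]sum1_card big_distrr /=; apply: eq_bigr => e eG.
rewrite muln1 -(card_edge eG) -sum1_card -big_mkcondr /=; apply: eq_bigl => x.
by apply/andb_idl/subsetP/edge_sub.
Qed.

Definition adj_in S : rel U := [rel x y | [&& adj G x y, x \in S & y \in S]].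

Definition edges_in S : {set {set U}} := [set e in eset G | e \subset S].

Definition connected_in S : Prop := {in S &, forall x y, connect (adj_in S) x y}.

Lemma adj_in_sym S : symmetric (adj_in S).
Proof. by move=> x y; rewrite /adj_in /= adj_sym [(x \in S) && _]andbC. Qed.

(* Two neighbours x, x' of y in S would close a cycle with a path from x to x'
   in S. *)
Lemma acyclic_neighbour_uniq S x x' y : acyclic G -> connected_in S ->
  x \in S -> x' \in S -> y \notin S -> adj G y x -> adj G y x' -> x = x'.
Proof.
move=> acG cS xS x'S yS yx yx'; apply/eqP/negPn/negP => xx'.
have /connectP[p0 p0P x'E] := cS _ _ xS x'S.
case: (shortenP p0P) x'E => p pP pU _ x'E.
(* Each step of [adj_in S] ends in [S], so the path avoids [y]. *)
have pS : {subset p <= S}.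
  elim: (p) {+}x pP {pU x'E} => // b q IH a /= /andP[/and3P[_ _ bS] /IH qS] z.
  by rewrite inE => /predU1P[->|/qS].
apply: (acG (y :: x :: p)).
  (* An empty [p] would force [x = x']; hence the cycle has at least three vertices. *)
  by case: (p) x'E => //= x'E; rewrite x'E eqxx in xx'.
apply/andP; split.
  rewrite /= rcons_path yx -x'E adj_sym yx' andbT.
  by apply: sub_path pP => a b /and3P[].
rewrite cons_uniq pU andbT inE negb_or (adj_neq yx) /=.
by apply: contra yS => /pS.
Qed.

(** If no edge left [S], then [S] would be closed under adjacency, and [z] could not be reached from
    [x]. *)
Lemma connected_exit S x z : connected G -> S \subset vset G ->
  x \in S -> z \in vset G -> z \notin S ->
  exists a b, [/\ a \in S, b \notin S & adj G a b].
Proof.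
move=> [_ cG] /subsetP SG xS zG zS.
case: (boolP [exists a in S, [exists b, (b \notin S) && adj G a b]]).
  move=> /exists_inP[a aS /existsP[b /andP[bS ab]]].
  by exists a, b.
rewrite negb_exists_in => /forall_inP noexit.
have clS a b : adj G a b -> a \in S -> b \in S.
  move=> ab /noexit; rewrite negb_exists => /forallP/(_ b).
  by rewrite ab andbT negbK.
have clo : fingraph.closed (adj G) (mem S).
  move=> a b ab; apply/idP/idP => /=; first exact: clS ab.
  by apply: clS; rewrite adj_sym.
by have := closed_connect clo (cG _ _ (SG _ xS) zG); rewrite /= xS (negPf zS).
Qed.

Lemma connected_in_add S x y : connected_in S -> x \in S -> adj G x y ->
  connected_in (y |: S).
Proof.
move=> cS xS xy.
have toS a b : connect (adj_in S) a b -> connect (adj_in (y |: S)) a b.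
  apply: connect_sub => c d /and3P[cd cS' dS]; apply: connect1.
  by rewrite /adj_in /= cd !inE cS' dS !orbT.
have from_x a : a \in y |: S -> connect (adj_in (y |: S)) x a.
  case/setU1P => [->|aS]; last exact/toS/cS.
  by apply: connect1; rewrite /adj_in /= xy !inE eqxx xS orbT.
move=> a b aS bS; apply: connect_trans (from_x b bS).
by rewrite (sym_connect_sym (@adj_in_sym _)) from_x.
Qed.

(** An edge gained by adding [y] must contain [y]. Its other end lies in [S], and acyclicity allows
    [y] only one neighbour there, namely [x]. *)
Lemma edges_in_add S x y : acyclic G -> connected_in S ->
  x \in S -> y \notin S -> adj G x y ->
  edges_in (y |: S) = [set x; y] |: edges_in S.
Proof.
move=> acG cS xS yS xy; apply/setP => e; rewrite !inE.
apply/idP/idP; last first.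
  case/predU1P => [->|/andP[-> /= eS]]; last exact: subset_trans eS (subsetU1 _ _).
  by apply/andP; split; rewrite // subUset !sub1set !inE eqxx xS orbT.
move=> /andP[eG /subsetP eyS]; rewrite eG /=.
case: (boolP (y \in e)) => [ye|ye]; apply/orP; [left|right].
  have [x' yx' eE] := edge_adj eG ye.
  have x'S : x' \in S.
    have := eyS x'; rewrite eE !inE eqxx orbT => /(_ isT).
    by rewrite eq_sym (negPf (adj_neq yx')).
  have yx : adj G y x by rewrite adj_sym.
  by rewrite eE (acyclic_neighbour_uniq acG cS xS x'S yS yx yx') setUC.
apply/subsetP => z ze; have /setU1P[zy|//] := eyS z ze.
by rewrite -zy ze in ye.
Qed.

(* Extend S by an edge leaving it: connectivity provides the edge, acyclicity
   makes it the only new one. *)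
Lemma tree_grow n : tree G -> n < #|vset G| ->
  exists S, [/\ S \subset vset G, #|S| = n.+1, connected_in S & #|edges_in S| = n].
Proof.
move=> [cG acG]; elim: n => [|n IH] nG.
  have /set0Pn[r rG] := proj1 cG; exists [set r]; split.
  - by rewrite sub1set.
  - exact: cards1.
  - by move=> x y /set1P-> /set1P->; exact: connect0.
  apply/eqP; rewrite cards_eq0; apply/eqP/setP => e; rewrite !inE.
  apply/negP => /andP[/card_edge e2 /subset_leq_card].
  by rewrite e2 cards1.
have [S [SG cardS cS eS]] := IH (ltnW nG).
have [x xS] : exists x, x \in S by apply/set0Pn; rewrite -card_gt0 cardS.
have /subsetPn[z zG zS] : ~~ (vset G \subset S).
  by apply/negP => /subset_leq_card; rewrite cardS leqNgt nG.
have [a [b [aS bS ab]]] := connected_exit cG SG xS zG zS.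
exists (b |: S); split.
- by rewrite subUset sub1set SG (adj_vset ab).
- by rewrite cardsU1 bS cardS.
- exact: connected_in_add ab.
(* The edge [[set a; b]] was not counted before, since [b] lies outside [S]; the count rises by
   exactly one. *)
rewrite (edges_in_add acG cS aS bS ab) cardsU1 eS inE.
by rewrite subUset !sub1set (negPf bS) !andbF.
Qed.

(** Growing up to [#|vset G|] vertices, that is with [n] equal to [#|vset G|.-1], exhausts the
    vertex set, and then every edge is counted. *)
Lemma tree_card_edges : tree G -> #|vset G| = #|eset G|.+1.
Proof.
move=> tG; have := proj1 (proj1 tG); rewrite -card_gt0 => V0.
have [S [SG cardS _ eS]] := tree_grow tG (etrans (ltn_predL _) V0).
have SE : S = vset G by apply/eqP; rewrite eqEcard SG cardS (ltn_predK V0) /=.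
suff <- : edges_in S = eset G by rewrite eS (ltn_predK V0).
apply/setP => e; rewrite inE SE; apply/andb_idr; exact: edge_sub.
Qed.

(** The first edge of a path from [x] to [y] is incident with [x]; the second vertex [y] excludes
    the one-vertex graph. *)
Lemma connected_degree_gt0 x y : connected G ->
  x \in vset G -> y \in vset G -> x != y -> 0 < degree G x.
Proof.
move=> [_ cG] xG yG xy; have /connectP[[|z p] /=] := cG _ _ xG yG.
  by move=> _ yx; rewrite yx eqxx in xy.
move=> /andP[xz _] _; rewrite card_gt0; apply/set0Pn.
by exists [set x; z]; rewrite !inE eqxx andbT.
Qed.

Lemma degree_gt0_neighbour x : 0 < degree G x -> exists y, adj G x y.
Proof.
rewrite card_gt0 => /set0Pn[e]; rewrite inE => /andP[eG xe].
by have [y xy _] := edge_adj eG xe; exists y.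
Qed.

End TreeEdges.

Section Complement.
Variables (U : finType) (G T : graph U).
Let H := edge_induced G (eset G :\: eset T).

Lemma eset_edge_inducedD : eset H = eset G :\: eset T.
Proof. by rewrite /= setIDA setIid. Qed.

Lemma vset_edge_induced (S : {set {set U}}) x :
  (x \in vset (edge_induced G S)) = (0 < degree (edge_induced G S) x).
Proof.
rewrite card_gt0; apply/bigcupP/set0Pn => [[e eH xe]|[e]].
  by exists e; rewrite inE eH.
by rewrite inE => /andP[eH xe]; exists e.
Qed.

Lemma edge_induced_subgraph (S : {set {set U}}) : subgraph (edge_induced G S) G.
Proof.
split; last exact: subsetIl.
by apply/bigcupsP => e /setIP[/edge_sub].
Qed.

Lemma degree_complement x : eset T \subset eset G ->
  degree G x = degree T x + degree H x.
Proof.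
move=> TG; rewrite /degree eset_edge_inducedD.
rewrite -(cardsID (eset T) [set e in eset G | x \in e]); congr (_ + _); apply: eq_card => e.
  by rewrite !inE; case: (boolP (e \in eset T)) => [/(subsetP TG)->|]; rewrite ?andbT ?andbF.
by rewrite !inE andbA.
Qed.

(** The boolean factor merges the cases of degree 2 and 0, so that summing over [vset G] directly
    counts [vset H]. *)
Lemma hist_complement_degree x : cubic G -> hist G T -> x \in vset G ->
  degree H x = 2 * (x \in vset H).
Proof.
move=> hG [[[_ TG] VT [cT _]] nd2] xG.
have d3 := hG x xG; have dTH := degree_complement x TG.
(* A neighbour in [G] is the second vertex that makes the degree of [x] in [T] positive. *)
have [y xy] : exists y, adj G x y by apply: degree_gt0_neighbour; rewrite d3.
have yG := (adj_vset xy).2.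
have dT : 0 < degree T x by apply: (connected_degree_gt0 (y := y)); rewrite ?VT ?(adj_neq xy).
have {}nd2 : degree T x <> 2 by apply: nd2; rewrite VT.
rewrite vset_edge_induced -/H; lia.
Qed.

End Complement.

Theorem theorem2 (U : finType) (G T : graph U) (hG : cubic G) (hT : hist G T) :
  let H := edge_induced G (eset G :\: eset T) in
  non_separating G H /\
  (#|vset H|%:R = #|vset G|%:R / 2 + 1 :> rat)%R.
Proof.
move=> H; have [[[_ TG] VT treeT] _] := hT; have [[V0 cT] _] := treeT.
have dH x : x \in vset G -> degree H x = 2 * (x \in vset H).
  exact: hist_complement_degree.
have [VH EH] : subgraph H G by exact: edge_induced_subgraph.
split.
  split=> //.
  (* [G] inherits connectedness from its spanning subgraph [T]. *)
  - split=> [|x y xG yG]; first by rewrite -VT.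
    apply: connect_sub (cT x y _ _); rewrite ?VT // => a b ab.
    by apply: connect1; exact: (subsetP TG).
  - by move=> x xH; rewrite dH ?xH // (subsetP VH).
  (* Deleting the complement of [T] leaves exactly the edges of [T], so connectedness is again that
     of [T]. *)
  have eE : eset (del_edges G (eset H)) = eset T.
    rewrite -[LHS]/(eset G :\: eset H) eset_edge_inducedD setDDr setDv set0U.
    exact/setIidPr.
  split=> [|x y xG yG]; first by rewrite -VT in V0 *.
  rewrite (eq_connect (e' := adj T)); first by apply: cT; rewrite VT.
  by move=> a b; rewrite /adj eE.
have sumG : \sum_(x in vset G) degree G x = 3 * #|vset G|.
  by rewrite (eq_bigr (fun=> 3)) ?sum_nat_const 1?mulnC // => x /hG.
have sumH : \sum_(x in vset G) degree H x = 2 * #|vset H|.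
  rewrite (eq_bigr _ dH) -big_distrr -big_mkcondr /= sum1_card.
  by congr (2 * _); apply: eq_card => x; apply/andb_idl/(subsetP VH).
have sumT : \sum_(x in vset G) degree T x = 2 * #|eset T|.
  by rewrite -VT handshake.
have : 3 * #|vset G| = 2 * #|eset T| + 2 * #|vset H|.
  rewrite -sumG -sumH -sumT -big_split; apply: eq_bigr => x _.
  exact: degree_complement.
have := tree_card_edges treeT; rewrite VT => cardT total.
(* Substituting [#|vset G| - 1] for the number of edges of [T] in the degree count; only afterwards
   is the equation halved, over the rationals. *)
have {total cardT} card : 2 * #|vset H| = #|vset G| + 2 by lia.
have : ((2 * #|vset H|)%:R = (#|vset G| + 2)%:R :> rat)%R by rewrite card.
rewrite GRing.natrM GRing.natrD; lra.
Qed.
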